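(* No class $\mathcal K\subseteq\mathrm{GL}_1$ has the Pseudojump Inversion Property.
   Context: Reals are elements of Cantor space $2^{\mathbb N}$, identified with subsets of $\mathbb N$; a class is a set of reals. $\leq_{\mathrm T},\equiv_{\mathrm T}$ denote Turing reducibility and equivalence. $(\Phi_e)_{e\in\mathbb N}$ is a standard effective enumeration of oracle Turing machines and $(W_e^X)_{e\in\mathbb N}$ a standard effective enumeration of the sets c.e. in $X$. The join is $(X\oplus Y)(2n)=X(n)$, $(X\oplus Y)(2n+1)=Y(n)$; the Turing jump is $X'=\{e:\Phi_e^X(e)\downarrow\}$, and $0'=\varnothing'$. $\mathrm{GL}_1=\{X\in 2^{\mathbb N}:X'\equiv_{\mathrm T}X\oplus 0'\}$. The pseudojump operators are $J_e(X)=X\oplus W_e^X$, $e\in\mathbb N$. A class $\mathcal C\subseteq 2^{\mathbb N}$ has the Pseudojump Inversion Property if for every real $A$ with $0'\leq_{\mathrm T}A$ and every $e\in\mathbb N$ there is $B\in\mathcal C$ with $A\equiv_{\mathrm T}J_e(B)\equiv_{\mathrm T}B\oplus 0'$. *)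

(* Defs.v *)
From HB Require Import structures.
From mathcomp Require Import all_boot.
From mathcomp Require Import boolp classical_sets.

Set Implicit Arguments.
Unset Strict Implicit.
Unset Printing Implicit Defensive.

Local Open Scope classical_set_scope.

Declare Scope turing_scope.
Delimit Scope turing_scope with turing.
Local Open Scope turing_scope.

(* An element of Cantor space, i.e. the characteristic function of a set of
   natural numbers; a class is then a term of type [set real]. *)
Definition real := nat -> bool.

(* Oracle computation is modelled by Kleene's schemes for the functions partial
   recursive in an oracle; by the relativized equivalence with oracle Turing
   machines this yields an acceptable numbering of the partial functionals.
   Codes carry no arity: a missing argument is read as 0. *)
Inductive code : Type :=
| Zero
| Succ
| Proj of nat
| Oracle
| Comp of code & seq code
| Prec of code & code
| Mu of code.

(* [eval X c s v]: with oracle [X], the program [c] halts on the arguments [s]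
   with output [v].  [Prec] recurses on, and [Mu] searches for, the first
   argument. *)
Inductive eval (X : real) : code -> seq nat -> nat -> Prop :=
| eval_zero s : eval X Zero s 0
| eval_succ s : eval X Succ s (nth 0 s 0).+1
| eval_proj i s : eval X (Proj i) s (nth 0 s i)
| eval_oracle s : eval X Oracle s (X (nth 0 s 0))
| eval_comp f gs s ts v :
    size ts = size gs ->
    (forall i, i < size gs -> eval X (nth Zero gs i) s (nth 0 ts i)) ->
    eval X f ts v ->
    eval X (Comp f gs) s v
| eval_prec0 f g s v :
    eval X f s v ->
    eval X (Prec f g) (0 :: s) v
| eval_precS f g n s r v :
    eval X (Prec f g) (n :: s) r ->
    eval X g [:: n, r & s] v ->
    eval X (Prec f g) (n.+1 :: s) v
| eval_mu f s n (k : nat -> nat) :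
    (forall m, m < n -> eval X f (m :: s) (k m).+1) ->
    eval X f (n :: s) 0 ->
    eval X (Mu f) s n.

(* The effective numbering of codes goes through the pickling of finitely
   branching trees. *)
Fixpoint code_tree (c : code) : GenTree.tree nat :=
  match c with
  | Zero => GenTree.Node 0 [::]
  | Succ => GenTree.Node 1 [::]
  | Proj i => GenTree.Leaf i
  | Oracle => GenTree.Node 2 [::]
  | Comp f gs => GenTree.Node 3 (code_tree f :: map code_tree gs)
  | Prec f g => GenTree.Node 4 [:: code_tree f; code_tree g]
  | Mu f => GenTree.Node 5 [:: code_tree f]
  end.

Fixpoint tree_code (t : GenTree.tree nat) : option code :=
  match t with
  | GenTree.Leaf i => Some (Proj i)
  | GenTree.Node 0 [::] => Some Zero
  | GenTree.Node 1 [::] => Some Succ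
  | GenTree.Node 2 [::] => Some Oracle
  | GenTree.Node 3 (t1 :: ts) =>
      if tree_code t1 is Some f then Some (Comp f (pmap tree_code ts)) else None
  | GenTree.Node 4 [:: t1; t2] =>
      match tree_code t1, tree_code t2 with
      | Some f, Some g => Some (Prec f g)
      | _, _ => None
      end
  | GenTree.Node 5 [:: t1] =>
      if tree_code t1 is Some f then Some (Mu f) else None
  | _ => None
  end.

Lemma code_treeK : pcancel code_tree tree_code.
Proof.
rewrite /pcancel; fix IH 1; case=> //= [f gs|f g|f]; rewrite ?IH //.
congr (Some (Comp f _)).
by elim: gs => //= g gs ihg; rewrite IH /= ihg.
Qed.

HB.instance Definition _ := Countable.copy code (pcan_type code_treeK).

(* [Phi e X n v] is "Phi_e^X(n) converges with value v"; an [e] which is not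
   the number of a code names the nowhere defined functional. *)
Definition Phi (e : nat) (X : real) (n v : nat) : Prop :=
  if unpickle e is Some c then eval X c [:: n] v else False.

Definition halts (e : nat) (X : real) (n : nat) : Prop :=
  exists v, Phi e X n v.

Definition W (e : nat) (X : real) : real := fun n => `[< halts e X n >].

Definition turing_le (X Y : real) : Prop :=
  exists e, forall n, Phi e Y n (X n).

Definition turing_equiv (X Y : real) : Prop :=
  turing_le X Y /\ turing_le Y X.

Notation "X <=T Y" := (turing_le X Y)
  (at level 70, no associativity) : turing_scope.
Notation "X =T Y" := (turing_equiv X Y)
  (at level 70, no associativity) : turing_scope.

Definition join (X Y : real) : real :=
  fun n => if odd n then Y n./2 else X n./2.

Definition jump (X : real) : real := fun e => `[< halts e X e >].

Definition empty_real : real := fun=> false.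

Definition zero_jump : real := jump empty_real.

Definition GL1 : set real := [set X | jump X =T join X zero_jump].

Definition pseudojump (e : nat) (X : real) : real := join X (W e X).

Definition pseudojump_inversion (C : set real) : Prop :=
  forall A : real, zero_jump <=T A -> forall e : nat,
  exists B : real,
    [/\ C B, A =T pseudojump e B & pseudojump e B =T join B zero_jump].

(* Main.v *)
Require Import Defs.
From mathcomp Require Import all_boot.
From mathcomp Require Import boolp classical_sets.

(** The trivial pseudojump already refutes the inversion property.  Take for
    [e] the number of a program that never halts, so that [W e X] is empty and
    [pseudojump e X] has the same Turing degree as [X].  Applying inversion to
    [zero_jump] and this [e] yields [B] in the class with
    [join B zero_jump <=T B]; if moreover [B] is in [GL1], then
    [jump B <=T join B zero_jump <=T B], contradicting the fact that no real
    computes its own jump.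

    In Kleene's schemes this needs transitivity of [turing_le], obtained by
    substituting a program for the oracle ([turing_le_trans]); the reduction of
    [join X empty_real] to [X] ([join_empty_le]); and the diagonal argument
    ([jump_not_le]), which rests on determinism of evaluation
    ([eval_functional]). *)

Local Open Scope classical_set_scope.
Local Open Scope turing_scope.

Lemma turing_leP (X Y : real) :
  X <=T Y <-> exists c, forall n, eval Y c [:: n] (X n).
Proof.
split=> [[e XY]|[c XY]]; last by exists (pickle c) => n; rewrite /Phi pickleK.
move: XY; rewrite /Phi; case: (unpickle e) => [c XY|XY]; first by exists c.
by case: (XY 0).
Qed.

Lemma eval_comp1 {X : real} {f g : code} {s : seq nat} {u v : nat} :
  eval X g s u -> eval X f [:: u] v -> eval X (Comp f [:: g]) s v.
Proof. by move=> gu; apply: eval_comp => // -[]. Qed.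

Lemma eval_comp2 {X : real} {f g h : code} {s : seq nat} {u t v : nat} :
  eval X g s u -> eval X h s t -> eval X f [:: u; t] v ->
  eval X (Comp f [:: g; h]) s v.
Proof. by move=> gu ht; apply: eval_comp => // -[|[]]. Qed.

Lemma eval_comp1_inv {X : real} {f g : code} {s : seq nat} {v : nat} :
  eval X (Comp f [:: g]) s v -> exists2 u, eval X g s u & eval X f [:: u] v.
Proof.
move=> ev; inversion ev as [| | | |? ? ? us ? size_us gu fu| | |]; subst.
case: us size_us gu fu => [|u []] // _ gu fu.
by exists u => //; apply: (gu 0).
Qed.

Lemma eval_functional (X : real) (c : code) (s : seq nat) (v w : nat) :
  eval X c s v -> eval X c s w -> v = w.
Proof.
move=> ev; elim: ev w => {c s v}.
- by move=> s w ew; inversion ew.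
- by move=> s w ew; inversion ew.
- by move=> i s w ew; inversion ew.
- by move=> s w ew; inversion ew.
- move=> f gs s ts v size_ts _ IHgs _ IHf w ew.
  inversion ew as [| | | |? ? ? us ? size_us gsu fw| | |]; subst.
  have -> // : v = w.
  apply: IHf; suff -> : ts = us by [].
  apply: (@eq_from_nth _ 0) => [|i]; first by rewrite size_ts.
  by rewrite size_ts => lt_i; apply: IHgs (gsu _ lt_i).
- by move=> f g s v _ IHf w ew; inversion ew; subst; apply: IHf.
- move=> f g n s r v _ IHr _ IHg w ew.
  inversion ew as [| | | | | |? ? ? ? r' ? er eg|]; subst.
  by apply: IHg; rewrite (IHr _ er).
- move=> f s n k _ IHlt _ IHn w ew.
  inversion ew as [| | | | | | |? ? ? k' elt en]; subst.
  by case: (ltngtP n w) => // [/elt/IHn|/IHlt/(_ _ en)].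
Qed.

(** An oracle call depends on its first argument only, whereas [d] may read
    further ones; the projection discards them. *)
Fixpoint oracle_subst (d c : code) : code :=
  match c with
  | Oracle => Comp d [:: Proj 0]
  | Comp f gs => Comp (oracle_subst d f) (map (oracle_subst d) gs)
  | Prec f g => Prec (oracle_subst d f) (oracle_subst d g)
  | Mu f => Mu (oracle_subst d f)
  | _ => c
  end.

Lemma eval_oracle_subst (Y Z : real) (d : code) :
  (forall n, eval Z d [:: n] (Y n)) ->
  forall c s v, eval Y c s v -> eval Z (oracle_subst d c) s v.
Proof.
move=> dY c s v; elim=> {c s v} /=; try by constructor.
- by move=> s; apply: eval_comp1 (eval_proj _ _ _) (dY _).
- move=> f gs s ts v size_ts _ IHgs _ IHf.
  apply: eval_comp IHf; rewrite size_map // => i lt_i.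
  by rewrite (nth_map Zero) //; apply: IHgs.
- by move=> f g n s r v _ IHr _; apply: eval_precS.
- by move=> f s n k _ IHlt _ IHn; apply: eval_mu IHlt IHn.
Qed.

Lemma turing_le_trans (X Y Z : real) : X <=T Y -> Y <=T Z -> X <=T Z.
Proof.
move=> /turing_leP[c cX] /turing_leP[d dY]; apply/turing_leP.
by exists (oracle_subst d c) => n; apply: eval_oracle_subst.
Qed.

Lemma turing_le_refl (X : real) : X <=T X.
Proof. by apply/turing_leP; exists Oracle => n; apply: (eval_oracle X [:: n]). Qed.

Definition odd_code : code :=
  Prec Zero (Comp (Prec (Comp Succ [:: Zero]) Zero) [:: Proj 1]).

Lemma eval_odd (X : real) (n : nat) : eval X odd_code [:: n] (odd n).
Proof.
elim: n => [|n IHn]; first by do 2!constructor.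
apply: eval_precS IHn _; apply: eval_comp1 (eval_proj _ _ _) _ => /=.
have neg0 : eval X (Prec (Comp Succ [:: Zero]) Zero) [:: 0] 1.
  by constructor; apply: eval_comp1 (eval_zero _ _) (eval_succ _ [:: 0]).
by case: (odd n) => //; apply: eval_precS neg0 _; constructor.
Qed.

Definition add_code : code := Prec (Proj 0) (Comp Succ [:: Proj 1]).

Lemma eval_add (X : real) (m n : nat) : eval X add_code [:: m; n] (m + n).
Proof.
elim: m => [|m IHm]; first by constructor; apply: (eval_proj X 0 [:: n]).
apply: eval_precS (IHm) _; rewrite addSn.
exact: eval_comp1 (eval_proj X 1 [:: m; m + n; n]) (eval_succ _ [:: m + n]).
Qed.

(** This is the recursion (n + 1)./2 = odd n + n./2. *)
Definition half_code : code :=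
  Prec Zero (Comp add_code [:: Comp odd_code [:: Proj 0]; Proj 1]).

Lemma eval_half (X : real) (n : nat) : eval X half_code [:: n] n./2.
Proof.
elim: n => [|n IHn]; first by do 2!constructor.
apply: eval_precS (IHn) _; rewrite [n.+1./2]uphalf_half.
apply: eval_comp2 (eval_add _ _ _); last exact: (eval_proj X 1 [:: n; n./2]).
exact: eval_comp1 (eval_proj X 0 [:: n; n./2]) (eval_odd X n).
Qed.

Lemma join_empty_le (X : real) : join X empty_real <=T X.
Proof.
apply/turing_leP.
(* Primitive recursion on the parity bit serves as a conditional. *)
exists (Comp (Prec Oracle Zero) [:: odd_code; half_code]) => n.
apply: eval_comp2 (eval_odd _ _) (eval_half _ _) _.
have even_case : eval X (Prec Oracle Zero) [:: 0; n./2] (X n./2).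
  by constructor; apply: (eval_oracle X [:: n./2]).
rewrite /join; case: (odd n) => //=.
by apply: eval_precS even_case _; constructor.
Qed.

(** If [c] computed [jump X] from [X], then the program that searches for some
    [m] at which [c], run on the input and ignoring [m], outputs 0 would halt
    on exactly the numbers outside [jump X]; its own number is then both in
    and outside [jump X]. *)
Lemma jump_not_le (X : real) : ~ jump X <=T X.
Proof.
move=> /turing_leP[c cX].
pose d := Mu (Comp c [:: Proj 1]); pose e := pickle d.
have haltsE : halts e X e <-> exists v, eval X d [:: e] v.
  by rewrite /halts /Phi {1 3}/e pickleK.
(* Inversion would otherwise try to compute the number of [d]. *)
clearbody e.
have := cX e; rewrite /jump; case: asboolP => [/haltsE[m dm]|nhalt] ce.
  inversion dm as [| | | | | | |? ? ? k _ c0]; subst.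
  have [u eu cu] := eval_comp1_inv c0.
  inversion eu; subst.
  by have := eval_functional _ _ _ _ _ ce cu.
apply/nhalt/haltsE; exists 0; apply: (@eval_mu X _ _ 0 id) => //.
exact: eval_comp1 (eval_proj X 1 [:: 0; e]) ce.
Qed.

Lemma W_diverging (X : real) : W (pickle (Mu Succ)) X = empty_real.
Proof.
apply: funext => n; apply/asboolP; rewrite /halts /Phi pickleK => -[v ev].
by inversion ev as [| | | | | | |? ? ? k _ succ0]; inversion succ0.
Qed.

Theorem proposition7p1 (K : set real) (hK : K `<=` GL1) :
  ~ pseudojump_inversion K.
Proof.
move=> /(_ _ (turing_le_refl zero_jump) (pickle (Mu Succ))) [B [KB _ [_]]].
rewrite /pseudojump W_diverging => join_le.
have [jump_le _] := hK _ KB.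
apply: (jump_not_le B); apply: turing_le_trans jump_le _.
exact: turing_le_trans join_le (join_empty_le B).
Qed.
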